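(* Let $X$ be an infinite-dimensional Banach space whose norm locally depends upon finitely many coordinates. Then $X$ does not have Lindenstrauss property A.
   Context: Banach spaces are over $\mathbb{K}=\mathbb{R}$ or $\mathbb{C}$ (the same field for all spaces involved). For Banach spaces $X,Z$, $L(X,Z)$ is the space of bounded linear operators from $X$ into $Z$ with the operator norm, and $NA(X,Z)$ is the set of those $T\in L(X,Z)$ attaining their norm, i.e. such that $\|T\|=\|Tx\|$ for some $x\in X$ with $\|x\|=1$. A Banach space $X$ has Lindenstrauss property A if $NA(X,Z)$ is dense in $L(X,Z)$ for every Banach space $Z$. The norm of a Banach space $X$ locally depends upon finitely many coordinates if for every $x\in X\setminus\{0\}$ there exist $\varepsilon>0$, a finite subset $\{f_1,\ldots,f_n\}$ of $X^*$ and a continuous function $\varphi:\mathbb{K}^n\to\mathbb{R}$ such that $\|y\|=\varphi(f_1(y),\ldots,f_n(y))$ for every $y\in X$ with $\|x-y\|<\varepsilon$. *)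

(* Defs.v *)
From HB Require Import structures.
From mathcomp Require Import all_boot all_order all_algebra.
From mathcomp Require Import all_classical all_reals all_analysis.
From mathcomp Require Import complex.

Set Implicit Arguments.
Unset Strict Implicit.
Unset Printing Implicit Defensive.

Import Order.TTheory GRing.Theory Num.Theory.
Import numFieldNormedType.Exports.

Local Open Scope classical_set_scope.
Local Open Scope ring_scope.

Definition real_or_complex (K : numFieldType) : Prop :=
  exists R : realType, K = R :> numFieldType \/ K = R[i] :> numFieldType.

Definition bounded_operators (K : numFieldType) (X Z : normedModType K) :
    set {linear X -> Z} :=
  [set T | exists M : K, forall x : X, `|T x| <= M * `|x|].
Arguments bounded_operators {K} X Z.

(* Norms are K-valued.  Over the complex numbers the order of K is partial,
   but a nonempty set of reals that is bounded above has its usual supremum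
   for that order.  The set below contains 0, so for bounded T the default
   value given to [supremum] plays no role. *)
Definition opnorm (K : numFieldType) (X Z : normedModType K)
    (T : {linear X -> Z}) : K :=
  supremum 0 [set `|T x| | x in [set x : X | `|x| <= 1]].

Definition norm_attaining_operators (K : numFieldType)
    (X Z : normedModType K) : set {linear X -> Z} :=
  [set T | bounded_operators X Z T /\
           exists x : X, `|x| = 1 /\ opnorm T = `|T x|].
Arguments norm_attaining_operators {K} X Z.

Definition dense_in_bounded_operators (K : numFieldType)
    (X Z : normedModType K) (D : set {linear X -> Z}) : Prop :=
  forall T, bounded_operators X Z T -> forall e : K, 0 < e ->
    exists2 S : {linear X -> Z}, D S & opnorm (T \- S) < e.

Definition Lindenstrauss_property_A (K : numFieldType)
    (X : completeNormedModType K) : Prop :=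
  forall Z : completeNormedModType K,
    dense_in_bounded_operators (norm_attaining_operators X Z).

Definition finite_dimensional (K : numFieldType) (X : lmodType K) : Prop :=
  exists (n : nat) (b : 'I_n -> X), forall x : X,
    exists c : 'I_n -> K, x = \sum_(i < n) c i *: b i.

(* A continuous map from K^n to the reals is encoded as a continuous K-valued
   map all of whose values are real, because norms are K-valued. *)
Definition norm_locally_finitely_many_coordinates (K : numFieldType)
    (X : normedModType K) : Prop :=
  forall x : X, x != 0 ->
    exists (e : K) (n : nat) (f : 'I_n -> {linear X -> K^o})
           (phi : 'rV[K]_n -> K),
      [/\ 0 < e,
          (forall i, bounded_operators X K^o (f i)),
          continuous phi,
          (forall v, phi v \is Num.real) &
          forall y : X, `|x - y| < e -> `|y| = phi (\row_i f i y)].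

(* Main.v *)
(* A strictly convex target sees only finite-dimensional behaviour of
   norm-attaining operators: if T attains its norm at x and the norm depends near
   x on f_1, ..., f_n, then |x + y| = |x - y| = |x| for small y killed by the
   f_i, so T (x + y) and T (x - y) are no longer than their midpoint T x, hence
   T y = 0.  Norm-attaining operators into such a target thus have finite rank.
   Take as target the bounded scalar sequences with the strictly convex norm
   sqrt (sup |z_k|^2 + sum_j 2^-j |z_j|^2), and as operator T y = (f_s y)_s, where
   f_s is a Hahn-Banach functional norming the s-th rational combination of an
   infinite linearly independent sequence.  T is bounded below on the span of that
   sequence, which meets the kernel of every finite-rank operator nontrivially, so
   T is not a limit of finite-rank operators. *)

From HB Require Import structures.
Require Import Defs.
From mathcomp Require Import all_boot all_order all_algebra.
From mathcomp Require Import all_classical all_reals all_analysis.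
From mathcomp Require Import complex.
From mathcomp Require Import ring lra.

Set Implicit Arguments.
Unset Strict Implicit.
Unset Printing Implicit Defensive.

Import Order.TTheory GRing.Theory Num.Theory.
Import numFieldNormedType.Exports.

Local Open Scope classical_set_scope.
Local Open Scope ring_scope.

(** * Real coordinates on the scalar field, for the real and complex cases at once *)

(* [unitJ] is the imaginary unit, or 0 over the reals; the imaginary part of z is
   [- re (unitJ * z)]. *)
Record real_coords (K : numFieldType) (R : realType) := RealCoords {
  of_real : {rmorphism R -> K};
  re : {additive K -> R};
  unitJ : K;
  of_real_ge0 : forall a, 0 <= a -> 0 <= of_real a;
  re_of_realM : forall a z, re (of_real a * z) = a * re z;
  re1 : re 1 = 1;
  reJ : re unitJ = 0;
  of_real_re : forall z, z \is Num.real -> of_real (re z) = z;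
  unitJ_cases : unitJ = 0 \/ unitJ * unitJ = -1;
  coordsE : forall z, z = of_real (re z) - unitJ * of_real (re (unitJ * z));
  re_norm_sqr : forall z, re `|z| ^+ 2 = re z ^+ 2 + re (unitJ * z) ^+ 2
}.

Lemma real_coords_real (R : realType) : real_coords R R.
Proof.
apply: (@RealCoords R R idfun idfun 0) => //=.
- by left.
- by move=> z; rewrite mul0r subr0.
- by move=> z; rewrite mul0r expr0n/= addr0 real_normK// num_real.
Qed.

Lemma Re_is_additive (R : rcfType) : additive (@complex.Re R).
Proof. by move=> [a b] [c d]. Qed.

Lemma real_coords_complex (R : realType) : real_coords R[i] R.
Proof.
pose re := HB.pack_for {additive R[i] -> R} (@complex.Re R)
  (GRing.isAdditive.Build _ _ (@complex.Re R) (@Re_is_additive R)).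
apply: (@RealCoords R[i] R (real_complex R) re (Complex 0 1)) => //=.
- by move=> a a0; rewrite lecE/= eqxx.
- by move=> a [b c] /=; rewrite mul0r subr0.
- by move=> [a b]; rewrite realE !lecE => /orP[]/andP[/eqP/= b0 _]; subst b.
- by right; apply/eqP; rewrite eq_complex/=; apply/andP; split; apply/eqP; ring.
- move=> [a b]; apply/eqP; rewrite eq_complex/=; apply/andP; split; apply/eqP; ring.
- move=> [a b] /=; rewrite sqr_sqrtr ?addr_ge0 ?sqr_ge0//; ring.
Qed.

Lemma real_or_complex_coords (K : numFieldType) :
  real_or_complex K -> exists R, inhabited (real_coords K R).
Proof.
case=> R [->|->]; exists R; constructor.
  exact: real_coords_real.
exact: real_coords_complex.
Qed.

Section RealCoords.
Variables (K : numFieldType) (R : realType) (S : real_coords K R).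
Local Notation of_real := (of_real S).
Local Notation re := (re S).
Local Notation unitJ := (unitJ S).

(** A real-valued copy of the norm, so that suprema and a total order are available over either
    field. *)
Definition rnorm (V : normedZmodType K) (x : V) : R := re `|x|.

Lemma of_realK a : re (of_real a) = a.
Proof. by rewrite -[of_real a]mulr1 re_of_realM re1 mulr1. Qed.

(** If [re z] were negative, [of_real] would send [- re z] to [- z], so z and -z would both be
    nonnegative, forcing z = 0. *)
Lemma re_ge0 z : 0 <= z -> 0 <= re z.
Proof.
move=> z0; rewrite leNgt; apply/negP => rz.
have : 0 <= of_real (- re z) by apply: of_real_ge0; rewrite oppr_ge0 ltW.
rewrite rmorphN of_real_re ?ger0_real// oppr_ge0 => z0'.
have zz : z = 0 by apply/eqP; rewrite eq_le z0 z0'.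
by rewrite zz raddf0 ltxx in rz.
Qed.

Lemma of_real_le a b : (of_real a <= of_real b) = (a <= b).
Proof.
apply/idP/idP => [|ab].
  by rewrite -subr_ge0 -rmorphB => /re_ge0; rewrite of_realK subr_ge0.
by rewrite -subr_ge0 -rmorphB of_real_ge0// subr_ge0.
Qed.

Lemma of_real_lt a b : (of_real a < of_real b) = (a < b).
Proof. by rewrite !lt_neqAle of_real_le (can_eq of_realK). Qed.

Lemma of_real_gt0 a : (0 < of_real a) = (0 < a).
Proof. by rewrite -[0 in LHS](rmorph0 of_real) of_real_lt. Qed.

Lemma re_gt0 z : 0 < z -> 0 < re z.
Proof. by move=> z0; rewrite -of_real_gt0 of_real_re// gtr0_real. Qed.

Section Rnorm.
Variable V : normedZmodType K.
Implicit Types x y : V.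

Lemma of_rnorm x : of_real (rnorm x) = `|x|.
Proof. by rewrite of_real_re// normr_real. Qed.

Lemma rnorm_ge0 x : 0 <= rnorm x.
Proof. exact: re_ge0. Qed.

Lemma rnorm_le x (a : R) : (rnorm x <= a) = (`|x| <= of_real a).
Proof. by rewrite -of_rnorm of_real_le. Qed.

Lemma rnorm_lt x (a : R) : (rnorm x < a) = (`|x| < of_real a).
Proof. by rewrite -of_rnorm of_real_lt. Qed.

Lemma rnormD x y : rnorm (x + y) <= rnorm x + rnorm y.
Proof. by rewrite rnorm_le rmorphD/= !of_rnorm ler_normD. Qed.

Lemma rnormN x : rnorm (- x) = rnorm x.
Proof. by rewrite /rnorm normrN. Qed.

Lemma rnormB x y : rnorm (x - y) = rnorm (y - x).
Proof. by rewrite /rnorm distrC. Qed.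

Lemma rnorm0 : rnorm (0 : V) = 0.
Proof. by rewrite /rnorm normr0 raddf0. Qed.

Lemma rnorm_eq0 x : (rnorm x == 0) = (x == 0).
Proof. by rewrite -(can_eq of_realK) of_rnorm rmorph0 normr_eq0. Qed.

End Rnorm.

Lemma rnormM (a b : K) : rnorm (a * b) = rnorm a * rnorm b.
Proof. by rewrite /rnorm normrM -(of_rnorm a) re_of_realM of_realK. Qed.

Lemma rnormZ (V : normedModType K) (a : K) (x : V) :
  rnorm (a *: x) = rnorm a * rnorm x.
Proof. by rewrite /rnorm normrZ -(of_rnorm a) re_of_realM of_realK. Qed.

Lemma rnorm_sqr (z : K) : rnorm z ^+ 2 = re z ^+ 2 + re (unitJ * z) ^+ 2.
Proof. exact: re_norm_sqr. Qed.

Lemma rnorm_of_real a : rnorm (of_real a) = `|a|.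
Proof.
apply/eqP; rewrite -(@eqrXn2 _ 2) ?rnorm_ge0// rnorm_sqr of_realK.
by rewrite mulrC re_of_realM reJ mulr0 expr0n addr0 real_normK ?num_real.
Qed.

Lemma ler_norm_re z : `|re z| <= rnorm z.
Proof.
rewrite -ler_sqr ?nnegrE ?rnorm_ge0// rnorm_sqr real_normK ?num_real//.
by rewrite lerDl sqr_ge0.
Qed.

Lemma rnormJ_le1 : rnorm unitJ <= 1.
Proof.
have [->|JJ] := unitJ_cases S; first by rewrite rnorm0.
have : rnorm unitJ ^+ 2 = 1.
  by rewrite expr2 -rnormM JJ rnormN -(rmorph1 of_real) rnorm_of_real normr1.
have := rnorm_ge0 unitJ; nra.
Qed.

Lemma rnorm_parallelogram (a b : K) :
  rnorm (a + b) ^+ 2 + rnorm (a - b) ^+ 2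
  = rnorm a ^+ 2 *+ 2 + rnorm b ^+ 2 *+ 2.
Proof. by rewrite !rnorm_sqr !(mulrDr, mulrN) !(raddfD, raddfN)/=; ring. Qed.

(** Both coordinates are 1-Lipschitz real functions, so they converge along [F]; [coordsE]
    reassembles their limits into a limit in K. *)
Lemma coords_complete (F : set_system K) : ProperFilter F -> cauchy F -> cvg F.
Proof.
move=> FF /cauchyP Fc.
have lim_coord (g : K -> R) : (forall y z, `|g y - g z| <= rnorm (y - z)) ->
    exists l, forall e, 0 < e -> F [set z | `|g z - l| < e].
  move=> g1.
  have /cauchy_cvg/cvg_ex[l gl] : cauchy (g @ F).
    apply/cauchyP => e e0.
    have [|z Fz] := Fc (of_real e); first by rewrite of_real_gt0.
    exists (g z); rewrite /fmap/=; apply: filterS Fz => y /=.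
    by rewrite -ball_normE/= -rnorm_lt -ball_normE/=; exact: le_lt_trans.
  exists l => e e0; move/cvgrPdist_lt : gl => /(_ e e0).
  by apply: filterS => z; rewrite distrC.
have [y z|a Fa] := lim_coord re; first by rewrite -raddfB ler_norm_re.
have [y z|b Fb] := lim_coord (fun z => re (unitJ * z)).
  rewrite -raddfB -mulrBr (le_trans (ler_norm_re _))// rnormM.
  by rewrite ler_piMl ?rnorm_ge0// rnormJ_le1.
apply/cvg_ex; exists (of_real a - unitJ * of_real b).
apply/cvgrPdist_lt => e e0; have e20 : 0 < re e / 2 by rewrite divr_gt0// re_gt0.
near=> z.
rewrite -(of_real_re S (gtr0_real e0)) -rnorm_lt rnormB.
have -> : z - (of_real a - unitJ * of_real b) =
    of_real (re z - a) - unitJ * of_real (re (unitJ * z) - b).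
  by rewrite {1}[z](coordsE S) !rmorphB/=; ring.
rewrite (le_lt_trans (rnormD _ _))// rnormN rnormM !rnorm_of_real.
rewrite [ltRHS]splitr ltr_leD//; first by near: z; exact: Fa.
rewrite (@le_trans _ _ `|re (unitJ * z) - b|) ?ler_piMl ?rnormJ_le1//.
by apply: ltW; near: z; exact: Fb.
Unshelve. all: by end_near. Qed.

End RealCoords.

(** * Bounded sequences under a strictly convex complete norm *)

Section BoundedSequences.
Variables (K : numFieldType) (R : realType) (S : real_coords K R).

Definition bounded_seq : {pred (nat -> K)} :=
  fun z => `[< exists B, forall n, rnorm S (z n) <= B >].

Lemma bounded_seq_submod : submod_closed bounded_seq.
Proof.
split; first by apply/asboolP; exists 0 => n; rewrite rnorm0.
move=> a x y /asboolP[B xB] /asboolP[C yC]; apply/asboolP.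
exists (rnorm S a * B + C) => n.
rewrite (le_trans (rnormD _ _ _))// lerD// rnormM.
by rewrite ler_wpM2l ?rnorm_ge0.
Qed.

HB.instance Definition _ :=
  GRing.isSubmodClosed.Build K (nat -> K) bounded_seq bounded_seq_submod.

Record linfty := Linfty {
  linfty_fun :> nat -> K;
  linftyP : linfty_fun \in bounded_seq
}.

HB.instance Definition _ := [isSub for linfty_fun].
HB.instance Definition _ := [Choice of linfty by <:].
HB.instance Definition _ := [SubChoice_isSubLmodule of linfty by <:].

Lemma linftyE (x y : linfty) : (forall n, x n = y n) -> x = y.
Proof. by move=> xy; apply/val_inj/funext. Qed.

Lemma linftyD (x y : linfty) n : (x + y) n = x n + y n.
Proof. by []. Qed.

Lemma linftyN (x : linfty) n : (- x) n = - x n.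
Proof. by []. Qed.

(** Truncating both the supremum and the series leaves the square of a Hilbertian seminorm, so the
    parallelogram law and the triangle inequality can be checked term by term in a finite sum. *)
Definition wsq k M (z : nat -> K) : R :=
  rnorm S (z k) ^+ 2 + \sum_(j < M) 2^-1 ^+ j * rnorm S (z j) ^+ 2.

Lemma half_exp_gt0 (j : nat) : 0 < 2^-1 ^+ j :> R.
Proof. by rewrite exprn_gt0// invr_gt0. Qed.

(** The constant is 1 plus the bound 2 on the geometric sum. Only indices up to [k + M] are
    constrained, so that along a filter finitely many coordinates need control. *)
Lemma wsq_le_sqr k M (z : nat -> K) (B : R) :
  (forall n, (n <= k + M)%N -> rnorm S (z n) <= B) -> wsq k M z <= 3 * B ^+ 2.
Proof.
move=> zB; have zB2 n : (n <= k + M)%N -> rnorm S (z n) ^+ 2 <= B ^+ 2.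
  move=> /zB {}zB.
  by rewrite lerXn2r ?nnegrE ?rnorm_ge0// (le_trans (rnorm_ge0 _ _) zB).
have -> : 3 * B ^+ 2 = B ^+ 2 + 2 * B ^+ 2 by ring.
rewrite lerD//; first by rewrite zB2// leq_addr.
apply: (@le_trans _ _ (\sum_(j < M) 2^-1 ^+ j * B ^+ 2)).
  apply: ler_sum => j _; rewrite ler_pM2l ?half_exp_gt0// zB2//.
  by rewrite (leq_trans (ltnW (ltn_ord j)))// leq_addl.
rewrite -mulr_suml ler_wpM2r ?sqr_ge0//.
have -> : \sum_(j < M) 2^-1 ^+ j = 2 - 2 * 2^-1 ^+ M :> R.
  elim: M {zB zB2} => [|M IH]; first by rewrite big_ord0 expr0; ring.
  by rewrite big_ord_recr/= IH exprS; field.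
by rewrite gerBl mulr_ge0// ltW// half_exp_gt0.
Qed.

Lemma wsqZ k M (a : K) (z : nat -> K) :
  wsq k M (a *: z) = rnorm S a ^+ 2 * wsq k M z.
Proof.
rewrite /wsq mulrDr; congr (_ + _); first by rewrite rnormM exprMn.
by rewrite mulr_sumr; apply: eq_bigr => j _; rewrite rnormM exprMn mulrCA.
Qed.

Lemma wsq_parallelogram k M (x y : nat -> K) :
  wsq k M (x + y) + wsq k M (x - y) = wsq k M x *+ 2 + wsq k M y *+ 2.
Proof.
rewrite /wsq addrACA rnorm_parallelogram -big_split/=.
under eq_bigr do rewrite -mulrDr rnorm_parallelogram mulrDr !mulrnAr.
by rewrite big_split/= !sumrMnl addrACA -!mulrnDl.
Qed.

(** Convexity of the square replaces Cauchy-Schwarz: (s + t)^2 <= (a + b)/a s^2 + (a + b)/b t^2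
    holds in each term, and these weights turn the bounds a^2 and b^2 into (a + b)^2. *)
Lemma wsqD_le k M (x y : nat -> K) (a b : R) : 0 < a -> 0 < b ->
  wsq k M x <= a ^+ 2 -> wsq k M y <= b ^+ 2 -> wsq k M (x + y) <= (a + b) ^+ 2.
Proof.
move=> a0 b0 xa yb.
have conv n : rnorm S (x n + y n) ^+ 2 <=
    (a + b) / a * rnorm S (x n) ^+ 2 + (a + b) / b * rnorm S (y n) ^+ 2.
  set s := rnorm S (x n); set t := rnorm S (y n).
  apply: (@le_trans _ _ ((s + t) ^+ 2)).
    by rewrite lerXn2r ?nnegrE ?addr_ge0 ?rnorm_ge0// rnormD.
  rewrite -subr_ge0.
  have -> : (a + b) / a * s ^+ 2 + (a + b) / b * t ^+ 2 - (s + t) ^+ 2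
    = (b * s - a * t) ^+ 2 / (a * b).
    by field; rewrite !gt_eqF.
  by rewrite divr_ge0 ?sqr_ge0// mulr_ge0// ltW.
apply: (@le_trans _ _ ((a + b) / a * wsq k M x + (a + b) / b * wsq k M y)).
  rewrite /wsq 2!mulrDr addrACA lerD//; first exact: conv.
  rewrite 2!mulr_sumr -big_split/=; apply: ler_sum => j _.
  by rewrite !(mulrCA _ (2^-1 ^+ j)) -mulrDr ler_pM2l ?half_exp_gt0//; exact: conv.
have -> : (a + b) ^+ 2 = (a + b) / a * a ^+ 2 + (a + b) / b * b ^+ 2.
  by field; rewrite !gt_eqF.
by rewrite lerD// ler_wpM2l// divr_ge0 ?addr_ge0// ltW.
Qed.

Definition wsqs (z : nat -> K) : set R := [set wsq km.1 km.2 z | km in setT].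

(* The supremum over both indices is sup_k |z_k|^2 + sum_j 2^-j |z_j|^2. *)
Definition bnorm (z : nat -> K) : R := Num.sqrt (sup (wsqs z)).

Lemma wsq_ge0 k M z : 0 <= wsq k M z.
Proof.
rewrite addr_ge0 ?sqr_ge0// sumr_ge0// => j _.
by rewrite mulr_ge0 ?sqr_ge0// ltW// half_exp_gt0.
Qed.

Lemma wsqs_has_sup (z : linfty) : has_sup (wsqs z).
Proof.
have /asboolP[B zB] := linftyP z; split; first by exists (wsq 0 0 z), (0, 0)%N.
by exists (3 * B ^+ 2) => _ [[k M] _ <-]; apply: wsq_le_sqr => n _.
Qed.

Lemma bnorm_ge0 z : 0 <= bnorm z. Proof. exact: sqrtr_ge0. Qed.

Lemma bnorm_sqr (z : linfty) : bnorm z ^+ 2 = sup (wsqs z).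
Proof.
rewrite sqr_sqrtr// (le_trans (wsq_ge0 0 0 z))//.
by apply: ub_le_sup; [exact: (wsqs_has_sup z).2|exists (0, 0)%N].
Qed.

Lemma wsq_le_bnorm k M (z : linfty) : wsq k M z <= bnorm z ^+ 2.
Proof.
by rewrite bnorm_sqr; apply: ub_le_sup; [exact: (wsqs_has_sup z).2|exists (k, M)].
Qed.

Lemma bnorm_le (z : linfty) (b : R) : 0 <= b ->
  (forall k M, wsq k M z <= b ^+ 2) -> bnorm z <= b.
Proof.
move=> b0 zb; rewrite -[leRHS]ger0_norm// -sqrtr_sqr ler_wsqrtr//.
by apply: ge_sup => [|_ [[k M] _ <-]]; [exact: (wsqs_has_sup z).1|exact: zb].
Qed.

Lemma rnorm_le_bnorm (z : linfty) n : rnorm S (z n) <= bnorm z.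
Proof.
rewrite -ler_sqr ?nnegrE ?rnorm_ge0 ?bnorm_ge0//.
by apply: le_trans (wsq_le_bnorm n 0 z); rewrite /wsq big_ord0 addr0.
Qed.

Lemma bnorm_eq0 (z : linfty) : bnorm z = 0 -> z = 0.
Proof.
move=> z0; apply: linftyE => n; apply/eqP; rewrite -(rnorm_eq0 S).
by rewrite eq_le rnorm_ge0 andbT -z0 rnorm_le_bnorm.
Qed.

Lemma bnormD (x y : linfty) : bnorm (x + y) <= bnorm x + bnorm y.
Proof.
have [x0|x0] := eqVneq (bnorm x) 0; first by rewrite x0 (bnorm_eq0 x0) !add0r.
have [y0|y0] := eqVneq (bnorm y) 0; first by rewrite y0 (bnorm_eq0 y0) !addr0.
apply: bnorm_le => [|k M]; first by rewrite addr_ge0 ?bnorm_ge0.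
by apply: wsqD_le; rewrite ?wsq_le_bnorm// lt_neqAle eq_sym ?x0 ?y0 bnorm_ge0.
Qed.

Lemma bnormZ (a : K) (x : linfty) : bnorm (a *: x) = rnorm S a * bnorm x.
Proof.
have leZ (c : K) (y : linfty) : bnorm (c *: y) <= rnorm S c * bnorm y.
  apply: bnorm_le => [|k M]; first by rewrite mulr_ge0 ?rnorm_ge0 ?bnorm_ge0.
  by rewrite wsqZ exprMn ler_wpM2l ?sqr_ge0// wsq_le_bnorm.
apply/eqP; rewrite eq_le leZ/=.
have [->|a0] := eqVneq a 0; first by rewrite rnorm0 mul0r bnorm_ge0.
have ra0 : 0 < rnorm S a by rewrite lt_neqAle eq_sym rnorm_eq0 a0 rnorm_ge0.
have := leZ a^-1 (a *: x); rewrite scalerA mulVf// scale1r.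
move=> /(ler_wpM2l (ltW ra0)); rewrite mulrA -rnormM divff//.
by rewrite -(rmorph1 (of_real S)) rnorm_of_real normr1 mul1r.
Qed.

Lemma of_real_bnormD (x y : linfty) :
  of_real S (bnorm (x + y)) <= of_real S (bnorm x) + of_real S (bnorm y).
Proof. by rewrite -rmorphD/= of_real_le bnormD. Qed.

Lemma of_real_bnormZ (a : K) (x : linfty) :
  of_real S (bnorm (a *: x)) = `|a| * of_real S (bnorm x).
Proof. by rewrite bnormZ rmorphM of_rnorm. Qed.

Lemma of_real_bnorm_eq0 (x : linfty) : of_real S (bnorm x) = 0 -> x = 0.
Proof.
by rewrite -(rmorph0 (of_real S)) => /(can_inj (of_realK S)); exact: bnorm_eq0.
Qed.

HB.instance Definition _ := Lmodule_isNormed.Build K linfty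
  of_real_bnormD of_real_bnormZ of_real_bnorm_eq0.

Lemma rnorm_linfty (x : linfty) : rnorm S x = bnorm x.
Proof. exact: of_realK. Qed.

(** The limit is built coordinatewise. Cauchy estimates pass to the limit in each truncation, and
    since they are uniform in k and M they bound the norm. *)
Lemma linfty_complete (F : set_system linfty) :
  ProperFilter F -> cauchy F -> cvg F.
Proof.
move=> FF /cauchyP Fc.
have lim_coord n : exists l, forall e, 0 < e ->
    F [set z : linfty | rnorm S (z n - l) <= e].
  have : cauchy ((fun z : linfty => z n) @ F).
    apply/cauchyP => e e0; have [z Fz] := Fc e e0.
    exists (z n); rewrite /fmap/=; apply: filterS Fz => y.
    rewrite -!ball_normE/= -[e](of_real_re S) ?gtr0_real// -!rnorm_lt.
    apply: le_lt_trans; rewrite [leRHS]rnorm_linfty.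
    exact: (rnorm_le_bnorm (z - y)).
  move=> /(coords_complete S)/cvg_ex[l zl]; exists l => e e0.
  move/cvgrPdist_le : zl => /(_ (of_real S e)); rewrite of_real_gt0 => /(_ e0).
  by apply: filterS => z; rewrite -rnorm_le rnormB.
have [l Fl] := choice lim_coord.
(* One [e] bounds the distance from [u] to a [z] far along the filter, the other that from [z] to
   [l] in the coordinates seen by [wsq k M]. *)
have wsq_lim (u : linfty) e : 0 < e -> F (ball u (of_real S e)) ->
    forall k M, wsq k M (linfty_fun u - l) <= (e + e) ^+ 2.
  move=> e0 Fu k M; near F => z.
  have -> : linfty_fun u - l = linfty_fun (u - z) + (linfty_fun z - l).
    by apply/funext => n; rewrite !fctE linftyD linftyN subrKA.
  apply: wsqD_le => //.
    rewrite (le_trans (wsq_le_bnorm _ _ _))// lerXn2r ?nnegrE ?bnorm_ge0 ?ltW//.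
    rewrite -rnorm_linfty rnorm_lt.
    by near: z; move: Fu; rewrite -ball_normE.
  (* With e/2, [wsq_le_sqr] gives 3 (e/2)^2 <= e^2. *)
  have : forall i : 'I_(k + M).+1, rnorm S (z i - l i) <= e / 2.
    by near: z; apply: filter_forall => i; apply: Fl; rewrite divr_gt0.
  move=> zl; apply: le_trans (@wsq_le_sqr k M _ (e / 2) _) _ => [n nkM|].
    exact: (zl (Ordinal (nkM : (n < (k + M).+1)%N))).
  nra.
have lP : l \in bounded_seq.
  have [|u Fu] := Fc (of_real S 1); first by rewrite of_real_gt0.
  have /asboolP[B uB] := linftyP u; apply/asboolP; exists (B + 2) => n.
  rewrite -[l n](subKr (u n)) (le_trans (rnormD _ _ _))// rnormN lerD//.
  have := wsq_lim u 1 ltr01 Fu n 0; rewrite /wsq big_ord0 addr0.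
  by rewrite ler_sqr ?nnegrE ?rnorm_ge0.
apply/cvg_ex; exists (Linfty lP); apply/cvgrPdist_lt => e e0.
(* Two thirds go to the distance from [u] to the limit, by [wsq_lim], and one third to that from [u]
   to [z]. *)
have e30 : 0 < re S e / 3 by rewrite divr_gt0// (re_gt0 S).
have [|u Fu] := Fc (of_real S (re S e / 3)); first by rewrite of_real_gt0.
near=> z; rewrite -[e](of_real_re S) ?gtr0_real// -rnorm_lt.
rewrite -(subrKA u) (le_lt_trans (rnormD _ _ _))//.
have -> : re S e = (re S e / 3 + re S e / 3) + re S e / 3 by field.
rewrite ler_ltD//.
  rewrite rnormB rnorm_linfty; apply: bnorm_le; first by rewrite addr_ge0// ltW.
  exact: wsq_lim.
by rewrite rnorm_lt; near: z; move: Fu; rewrite -ball_normE.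
Unshelve. all: by end_near. Qed.

HB.instance Definition _ := Uniform_isComplete.Build linfty linfty_complete.

(* The parallelogram law for each [wsq k M] gives an inequality for their
   supremum. *)
Lemma linfty_strictly_convex (z w : linfty) :
  `|z + w| <= `|z| -> `|z - w| <= `|z| -> w = 0.
Proof.
rewrite -(of_rnorm S z) -!rnorm_le !rnorm_linfty => zDw zBw.
apply: linftyE => m; apply/eqP; rewrite -(rnorm_eq0 S); apply/negP => wm0.
have c0 : 0 < 2^-1 ^+ m * rnorm S (w m) ^+ 2.
  rewrite mulr_gt0 ?half_exp_gt0// exprn_gt0// lt_neqAle eq_sym rnorm_ge0 andbT.
  exact/negP.
set c := _ * _ in c0.
suff : bnorm z ^+ 2 <= bnorm z ^+ 2 - c by lra.
rewrite {1}bnorm_sqr; apply: ge_sup => [|_ [[k M] _ <-]/=].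
  exact: (wsqs_has_sup z).1.
(* Summing [m.+1 + M] terms brings index m into the sum, so [w] contributes at least [c], while the
   truncation at [z] does not decrease. *)
have wsq_mono : wsq k M z <= wsq k (m.+1 + M) z.
  rewrite lerD2l addnC big_split_ord/= lerDl sumr_ge0// => j _.
  by rewrite mulr_ge0 ?sqr_ge0// ltW// half_exp_gt0.
have wc : c <= wsq k (m.+1 + M) w.
  rewrite /wsq (bigD1 (lshift M ord_max))//= addrCA lerDl addr_ge0 ?sqr_ge0//.
  by rewrite sumr_ge0// => j _; rewrite mulr_ge0 ?sqr_ge0// ltW// half_exp_gt0.
have sqr_le (y : linfty) : bnorm y <= bnorm z ->
    wsq k (m.+1 + M) y <= bnorm z ^+ 2.
  move=> yz; rewrite (le_trans (wsq_le_bnorm _ _ _))//.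
  by rewrite lerXn2r ?nnegrE ?bnorm_ge0.
have zDw' : wsq k (m.+1 + M) (linfty_fun z + linfty_fun w) <= bnorm z ^+ 2.
  exact: (sqr_le (z + w)).
have zBw' : wsq k (m.+1 + M) (linfty_fun z - linfty_fun w) <= bnorm z ^+ 2.
  exact: (sqr_le (z - w)).
have := wsq_parallelogram k (m.+1 + M) z w.
lra.
Qed.

End BoundedSequences.

(** * Norming functionals by Zorn's lemma on graphs *)

Section HahnBanach.
Variables (K : numFieldType) (R : realType) (S : real_coords K R).
Variable V : normedModType K.
Local Notation of_real := (of_real S).
Local Notation unitJ := (unitJ S).

(* Graphs of norm-one real-linear functionals on real subspaces of V; such a
   relation is automatically functional, since (0, r) in it forces r <= 0. *)
Definition dominated_graph (G : set (V * R)) :=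
  (forall a x r z s, G (x, r) -> G (z, s) ->
    G (of_real a *: x + z, a * r + s)) /\
  (forall x r, G (x, r) -> r <= rnorm S x).

Definition line_graph (y : V) : set (V * R) :=
  [set (of_real a *: y, a * rnorm S y) | a in setT].

Lemma dominated_line_graph y : dominated_graph (line_graph y).
Proof.
split=> [a _ _ _ _ [b _ [<- <-]] [c _ [<- <-]]|_ _ [a _ [<- <-]]].
  exists (a * b + c) => //; rewrite rmorphD rmorphM/= scalerDl scalerA.
  by congr (_, _); ring.
by rewrite rnormZ rnorm_of_real ler_wpM2r ?rnorm_ge0// ler_norm.
Qed.

(** The value c at x0 must lie above every r - |x - x0| and below every |x + x0| - r; these are
    compatible because r + s <= |x + z| <= |x + x0| + |z - x0|. After division by |a|, the upper
    bound handles a > 0 and the lower bound a < 0. *)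
Lemma dominated_graph_extend (G : set (V * R)) (x0 : V) :
  dominated_graph G -> G (0, 0) ->
  exists c, dominated_graph
    [set q | exists x r a, G (x, r) /\ q = (x + of_real a *: x0, r + a * c)].
Proof.
move=> [Glin Gdom] G0.
have Gscale a x r : G (x, r) -> G (of_real a *: x, a * r).
  by move=> Gx; have := Glin a _ _ _ _ Gx G0; rewrite !addr0.
pose L := [set t | exists x r, G (x, r) /\ t = r - rnorm S (x - x0)].
have Lub x r : G (x, r) -> ubound L (rnorm S (x + x0) - r).
  move=> Gx _ [z [s [Gz ->]]].
  have := Gdom _ _ (Glin 1 _ _ _ _ Gx Gz); rewrite rmorph1 scale1r mul1r.
  have := rnormD S (x + x0) (z - x0); rewrite addrACA subrr addr0.
  lra.
have L0 : L !=set0 by exists (0 - rnorm S (0 - x0)), 0, 0.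
have Lsup : has_sup L by split=> //; exists (rnorm S (0 + x0) - 0); exact: Lub.
have supL x r : G (x, r) -> r - rnorm S (x - x0) <= sup L.
  by move=> Gx; apply: ub_le_sup; [exact: Lsup.2|exists x, r].
have Lsup_le x r : G (x, r) -> sup L <= rnorm S (x + x0) - r.
  by move=> Gx; apply: ge_sup => //; exact: Lub.
exists (sup L); split.
  move=> a _ _ _ _ [x [r [b [Gx [-> ->]]]]] [z [s [c [Gz [-> ->]]]]].
  exists (of_real a *: x + z), (a * r + s), (a * b + c).
  split; first exact: Glin.
  rewrite rmorphD rmorphM/= scalerDr scalerDl scalerA addrACA.
  by congr (_, _); ring.
move=> _ _ [x [r [a [Gx [-> ->]]]]].
have [a0|b0|<-] := ltgtP 0 a.
- have := Lsup_le _ _ (Gscale a^-1 _ _ Gx).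
  have -> : x + of_real a *: x0 = of_real a *: (of_real a^-1 *: x + x0).
    by rewrite scalerDr scalerA -rmorphM/= divff ?gt_eqF// rmorph1 scale1r.
  rewrite rnormZ rnorm_of_real gtr0_norm//; set n := rnorm S _.
  move=> /(ler_wpM2l (ltW a0)); rewrite mulrBr mulrA divff ?gt_eqF// mul1r.
  lra.
- rewrite -oppr_gt0 in b0.
  have := supL _ _ (Gscale (- a)^-1 _ _ Gx).
  have -> : x + of_real a *: x0 =
      of_real (- a) *: (of_real (- a)^-1 *: x - x0).
    rewrite scalerBr scalerA -rmorphM/= divff ?gt_eqF// rmorph1 scale1r.
    by rewrite rmorphN scaleNr opprK.
  rewrite rnormZ rnorm_of_real gtr0_norm//; set n := rnorm S _.
  move=> /(ler_wpM2l (ltW b0)); rewrite mulrBr mulrA divff ?gt_eqF// mul1r.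
  lra.
- by rewrite rmorph0 scale0r addr0 mul0r addr0; exact: Gdom.
Qed.

Lemma real_hahn_banach (y : V) : exists u : V -> R,
  [/\ forall a x z, u (of_real a *: x + z) = a * u x + u z,
      forall x, u x <= rnorm S x & u y = rnorm S y].
Proof.
(* Uniting with the line through [y] keeps [y] in every domain and makes the empty chain harmless,
   its union being the empty set. *)
pose P := [set A : set (V * R) | dominated_graph (A `|` line_graph y)].
have [F FP Ftot|A [PA maxA]] := @Zorn_bigcup _ P.
  (* Being dominated is a condition on at most two points at a time, so it is enough to find any two
     points of the union in a common dominated graph. *)
  have FW p q : (\bigcup_(X in F) X `|` line_graph y) p ->
      (\bigcup_(X in F) X `|` line_graph y) q ->
      exists W, [/\ dominated_graph W, W p, W q &
        W `<=` \bigcup_(X in F) X `|` line_graph y].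
    have sub X : F X -> X `|` line_graph y `<=` \bigcup_(X in F) X `|` line_graph y.
      by move=> FX; apply: setSU => z Xz; exists X.
    move=> [[X FX Xp]|lp] [[Y FY Yq]|lq].
    - have [XY|YX] := Ftot _ _ FX FY.
        exists (Y `|` line_graph y); split; [exact: FP|left; exact: XY|by left|].
        exact: sub.
      exists (X `|` line_graph y); split; [exact: FP|by left|left; exact: YX|].
      exact: sub.
    - exists (X `|` line_graph y); split; [exact: FP|by left|by right|exact: sub].
    - exists (Y `|` line_graph y); split; [exact: FP|by right|by left|exact: sub].
    - exists (line_graph y); split=> //; exact: dominated_line_graph.
  split=> [a x r z s xr zs|x r xr].
    by have [W [[Wlin _] Wxr Wzs]] := FW _ _ xr zs; apply; exact: Wlin.
  by have [W [[_ Wdom] Wxr _ _]] := FW _ _ xr xr; exact: Wdom.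
set G := A `|` line_graph y in PA.
have [Glin Gdom] := PA : dominated_graph G.
have Gline : line_graph y `<=` G by exact: subsetUr.
have G0 : G (0, 0) by apply: Gline; exists 0 => //; rewrite rmorph0 scale0r mul0r.
(* If no value were assigned to [x], the extension by [x] would contain the pair (x, c) missing from
   [A], against maximality. *)
have Gtot x : exists r, G (x, r).
  have [c Bdom] := dominated_graph_extend x PA G0.
  set B := [set q | _] in Bdom.
  have GB : G `<=` B.
    by move=> [z r] Gz; exists z, r, 0; rewrite rmorph0 scale0r mul0r !addr0.
  exists c; apply: contrapT => Gxc; apply: (maxA B).
    split; first by move=> z Az; apply: GB; left.
    move=> BA; apply: Gxc; left; apply: BA.
    by exists 0, 0, 1; rewrite rmorph1 scale1r mul1r !add0r.
  by rewrite /P/= (setUidl (subset_trans Gline GB)).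
have Guniq x r s : G (x, r) -> G (x, s) -> r = s.
  move=> Gr Gs; have := Gdom _ _ (Glin (-1) _ _ _ _ Gr Gs).
  have := Gdom _ _ (Glin (-1) _ _ _ _ Gs Gr).
  rewrite !rmorphN !rmorph1 !scaleN1r addNr rnorm0; lra.
have [u Gu] := choice Gtot; exists u; split.
- by move=> a x z; apply: Guniq (Gu _) _; apply: Glin.
- by move=> x; exact: Gdom.
- by apply: Guniq (Gu y) _; apply: Gline; exists 1; rewrite // rmorph1 scale1r mul1r.
Qed.

(* [f x = u x - i u (i x)] with u real-linear; the crude bound 2 is enough. *)
Lemma hahn_banach (y : V) : exists f : {linear V -> K^o},
  (forall x, rnorm S (f x) <= 2 * rnorm S x) /\ rnorm S y <= rnorm S (f y).
Proof.
have [u [ulin udom uy]] := real_hahn_banach y.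
have u0 : u 0 = 0 by have := ulin 1 0 0; rewrite rmorph1 scaler0 addr0; lra.
have uZ a x : u (of_real a *: x) = a * u x by have := ulin a x 0; rewrite u0 !addr0.
have uD x z : u (x + z) = u x + u z.
  by have := ulin 1 x z; rewrite rmorph1 scale1r mul1r.
have uN x : u (- x) = - u x.
  by have := uZ (-1) x; rewrite rmorphN rmorph1 scaleN1r mulN1r.
have uabs x : `|u x| <= rnorm S x.
  by rewrite ler_norml udom -(rnormN S x) andbT lerNl -uN udom.
pose f x : K^o := of_real (u x) - unitJ * of_real (u (unitJ *: x)).
have fD x z : f (x + z) = f x + f z.
  by rewrite /f scalerDr !uD !rmorphD/=; ring.
have fZ a x : f (of_real a *: x) = of_real a * f x.
  by rewrite /f uZ scalerA [unitJ * of_real a]mulrC -scalerA uZ !rmorphM/=; ring.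
(* Together with real linearity this gives linearity over K, by splitting a scalar with
   [coordsE]. *)
have fJ x : f (unitJ *: x) = unitJ * f x.
  rewrite /f scalerA; have [->|JJ] := unitJ_cases S.
    by rewrite mul0r !scale0r u0 rmorph0 !mul0r subr0.
  rewrite JJ scaleN1r uN rmorphN/= mulrBr mulrA JJ; ring.
have flin : linear f.
  move=> a x z; rewrite fD; congr (_ + _); rewrite [a](coordsE S).
  set b := re S a; set c := re S _.
  rewrite scalerBl -scaleNr [unitJ * _]mulrC -mulNr -rmorphN -scalerA fD !fZ fJ.
  rewrite rmorphN.
  rewrite /GRing.scale/=; ring.
pose g := HB.pack_for {linear V -> K^o} f (GRing.isLinear.Build _ _ _ _ f flin).
exists g; split=> [x|].
  rewrite (le_trans (rnormD _ _ _))// rnormN rnormM !rnorm_of_real.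
  have := uabs x; have := uabs (unitJ *: x); rewrite rnormZ.
  have := rnormJ_le1 S; have := rnorm_ge0 S unitJ; have := rnorm_ge0 S x.
  have := normr_ge0 (u (unitJ *: x)); nra.
have <- : re S (f y) = rnorm S y.
  rewrite raddfB/= of_realK [unitJ * _]mulrC re_of_realM reJ mulr0 subr0.
  exact: uy.
exact: le_trans (ler_norm _) (ler_norm_re _ _).
Qed.

End HahnBanach.

(** * Operator norm and kernels of norm-attaining operators *)

Section Operators.
Variables (K : numFieldType) (R : realType) (S : real_coords K R).
Variables X Z : normedModType K.

Lemma re_le (a b : K) : a <= b -> re S a <= re S b.
Proof. by move=> ab; rewrite -subr_ge0 -raddfB re_ge0// subr_ge0. Qed.

Lemma bounded_operator_rnorm (T : {linear X -> Z}) : bounded_operators X Z T ->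
  exists M, forall x, rnorm S (T x) <= M * rnorm S x.
Proof.
move=> [M TM]; exists (re S M) => x; rewrite (le_trans (re_le (TM x)))//.
by rewrite -(of_rnorm S x) mulrC re_of_realM mulrC.
Qed.

(** Since the order of K may be partial, a supremum has to be exhibited: it is the [of_real] image
    of the real supremum of the values [rnorm S (T x)]. Hence [opnorm] is a true supremum and not a
    default value. *)
Lemma opnorm_ge (T : {linear X -> Z}) x : bounded_operators X Z T ->
  `|x| <= 1 -> `|T x| <= opnorm T.
Proof.
move=> /bounded_operator_rnorm[M TM] x1.
set A := [set `|T x| | x in [set x : X | `|x| <= 1]].
pose B := [set rnorm S (T x) | x in [set x : X | `|x| <= 1]].
have B0 : B !=set0 by exists (rnorm S (T x)), x.
have Bsup : has_sup B.
  split=> //; exists `|M| => _ [z z1 <-]; rewrite (le_trans (TM z))//.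
  rewrite (le_trans (ler_norm _))// normrM ler_piMr//.
  by rewrite ger0_norm ?rnorm_ge0// rnorm_le rmorph1.
have Asup : supremums A (of_real S (sup B)).
  split=> [_ [z z1 <-]|b Ab].
    by rewrite -rnorm_le; apply: ub_le_sup; [exact: Bsup.2|exists z].
  have b0 : 0 <= b by rewrite (le_trans _ (Ab `|T x| _))//; exists x.
  rewrite -(of_real_re S (ger0_real b0)) of_real_le; apply: ge_sup => //.
  move=> _ [z z1 <-]; rewrite rnorm_le of_real_re ?ger0_real//.
  by apply: Ab; exists z.
rewrite /opnorm /supremum -/A ifF; last first.
  apply/negP => /eqP A0; suff : A `|T x| by rewrite A0.
  by exists x.
case: xgetP => [y _ [Aub _]|/(_ _ Asup)//].
by apply: Aub; exists x.
Qed.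

Lemma ler_opnorm (T : {linear X -> Z}) x : bounded_operators X Z T ->
  `|T x| <= opnorm T * `|x|.
Proof.
move=> Tb; have [->|x0] := eqVneq x 0; first by rewrite linear0 !normr0 mulr0.
rewrite -ler_pdivrMr ?normr_gt0// mulrC -[`|x|^-1]ger0_norm ?invr_ge0//.
rewrite -normrZ -linearZ opnorm_ge//.
by rewrite normfZV.
Qed.

Lemma norm_attaining_kernel (T : {linear X -> Z}) :
  (forall z w : Z, `|z + w| <= `|z| -> `|z - w| <= `|z| -> w = 0) ->
  norm_locally_finitely_many_coordinates X ->
  norm_attaining_operators X Z T ->
  exists n (f : 'I_n -> {linear X -> K^o}),
    forall y, (forall i, f i y = 0) -> T y = 0.
Proof.
move=> convZ Xloc [Tb [x [x1 Tx]]].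
have [|e [n [f [phi [e0 _ _ _ xphi]]]]] := Xloc x.
  by rewrite -normr_gt0 x1.
exists n, f => y fy.
(* This scale puts [t *: y] in the ball of radius [e]; adding 1 to the denominator covers y = 0. *)
pose t := e / (1 + `|y|).
have y1 : 0 < 1 + `|y| by rewrite ltr_pwDl.
have t0 : 0 < t by rewrite divr_gt0.
have ty : `|t *: y| < e.
  by rewrite normrZ gtr0_norm// /t mulrAC ltr_pdivrMr// ltr_pM2l// ltrDr.
(* [phi] receives the same coordinates at x + w and at x, so x + w is again a unit vector and the
   norm of T, attained at x, bounds its image. *)
have Txw w : `|w| < e -> (forall i, f i w = 0) -> `|T (x + w)| <= `|T x|.
  move=> we fw; rewrite -Tx opnorm_ge// xphi; last by rewrite opprD addNKr normrN.
  have -> : \row_i f i (x + w) = \row_i f i x.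
    by apply/rowP => i; rewrite !mxE raddfD/= fw addr0.
  by rewrite -xphi ?x1// subrr normr0.
have fty i : f i (t *: y) = 0 by rewrite linearZ/= fy scaler0.
have : T (t *: y) = 0.
  apply: (convZ (T x)); rewrite -(raddfD, raddfB); first exact: Txw.
  by apply: Txw => [|i]; rewrite ?normrN// raddfN/= fty oppr0.
rewrite linearZ/= => /eqP; rewrite scaler_eq0 gt_eqF//= => /eqP//.
Qed.

End Operators.

(** * Linear independence and common kernels of finitely many functionals *)

Section IndependentSequence.
Variables (K : numFieldType) (X : lmodType K).

(** A function [g] picks a vector outside the span of each finite list; feeding it the list of its
    own earlier values produces the sequence. *)
Lemma independent_sequence : ~ finite_dimensional X ->
  exists x : nat -> X, forall n (c : nat -> K), x n <> \sum_(i < n) c i *: x i.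
Proof.
move=> Xinf.
have [g gP] : {g : seq X -> X &
    forall s (c : nat -> K), g s <> \sum_(i < size s) c i *: s`_i}.
  apply: (@choice _ _ (fun s v =>
    forall c : nat -> K, v <> \sum_(i < size s) c i *: s`_i)).
  move=> s; apply: contrapT => nv; apply: Xinf.
  exists (size s), (fun i => s`_i) => v; apply: contrapT => nc.
  by apply: nv; exists v => c vc; apply: nc; exists (fun i => c i).
pose t := fix t n := if n is m.+1 then rcons (t m) (g (t m)) else [::].
have st n : size (t n) = n by elim: n => //= n IH; rewrite size_rcons IH.
have tE n i : (i < n)%N -> (t n)`_i = g (t i).
  elim: n => //= n IH; rewrite ltnS leq_eqVlt => /orP[/eqP->|ni].
    by rewrite nth_rcons st ltnn eqxx.
  by rewrite nth_rcons st ni IH.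
exists (fun n => g (t n)) => n c xn; apply: (gP (t n) c); rewrite xn st.
by apply: eq_bigr => i _; rewrite tE.
Qed.

Lemma independent_sequence_eq0 (x : nat -> X) :
  (forall n (c : nat -> K), x n <> \sum_(i < n) c i *: x i) ->
  forall n (c : nat -> K), \sum_(i < n) c i *: x i = 0 ->
  forall i, (i < n)%N -> c i = 0.
Proof.
move=> xind; elim=> [//|n IH] c; rewrite big_ord_recr/= => c0.
have cn : c n = 0.
  apply/eqP; apply: contrapT => /negP cn.
  apply: (xind n (fun i => - (c n)^-1 * c i)).
  under eq_bigr do rewrite -scalerA.
  rewrite -scaler_sumr scaleNr -scalerN.
  move/eqP: c0; rewrite addrC addr_eq0 => /eqP <-.
  by rewrite scalerA mulVf// scale1r.
move: c0; rewrite cn scale0r addr0 => /IH {}IH i.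
by rewrite ltnS leq_eqVlt => /orP[/eqP->|/IH].
Qed.

(** There are n equations in n + 1 unknowns: the matrix of values has more rows than columns, hence
    a nonzero left kernel. *)
Lemma common_kernel_combination (x : nat -> X) n (f : 'I_n -> {linear X -> K^o}) :
  exists2 c : nat -> K, exists2 i, (i < n.+1)%N & c i != 0 &
    forall k, f k (\sum_(i < n.+1) c i *: x i) = 0.
Proof.
pose A := \matrix_(j < n.+1, i < n) (f i (x j) : K).
have /rowV0Pn[v vA v0] : kermx A != 0.
  by rewrite -mxrank_eq0 mxrank_ker -lt0n subn_gt0 ltnS rank_leq_col.
have {}vA : v *m A = 0 by exact/sub_kermxP.
have /rV0Pn[j vj] := v0.
exists (fun i => v 0 (inord i)).
  by exists j => //; rewrite inord_val.
move=> k; rewrite raddf_sum; have := congr1 (fun w : 'rV_n => w 0 k) vA.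
rewrite !mxE => vAk; rewrite -[RHS]vAk; apply: eq_bigr => i _.
by rewrite mxE inord_val; exact: linearZ.
Qed.

End IndependentSequence.

(** * An operator bounded below on the span of a sequence *)

Section NormingOperator.
Variables (K : numFieldType) (R : realType) (S : real_coords K R).
Variables (X : normedModType K) (x : nat -> X).

Definition rational_scalar (pq : rat * rat) : K :=
  of_real S (ratr pq.1) + unitJ S * of_real S (ratr pq.2).

(** Indexing by lists of pairs of rationals, a countable type, lets [unpickle] enumerate these
    vectors along the coordinates of the target. *)
Definition rational_combination (s : seq (rat * rat)) : X :=
  \sum_(i < size s) rational_scalar (nth (0, 0) s i) *: x i.

Lemma rational_scalar_dense (z : K) (e : R) : 0 < e ->
  exists pq, rnorm S (z - rational_scalar pq) < e.
Proof.
move=> e0; have e20 : 0 < e / 2 by rewrite divr_gt0.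
have ratP (a : R) : exists p : rat, `|a - ratr p| < e / 2.
  have [|p] := @rat_in_itvoo R (a - e / 2) (a + e / 2); first by lra.
  by rewrite in_itv/= => pa; exists p; rewrite distrC ltr_distl.
have [p pP] := ratP (re S z); have [q qP] := ratP (- re S (unitJ S * z)).
exists (p, q); rewrite /rational_scalar/=.
have -> : z - (of_real S (ratr p) + unitJ S * of_real S (ratr q)) =
    of_real S (re S z - ratr p)
    + unitJ S * of_real S (- re S (unitJ S * z) - ratr q).
  by rewrite {1}[z](coordsE S) !rmorphB rmorphN/=; ring.
rewrite (le_lt_trans (rnormD _ _ _))// rnormM !rnorm_of_real.
rewrite [ltRHS]splitr ltr_leD//.
by rewrite (le_trans _ (ltW qP))// ler_piMl// rnormJ_le1.
Qed.

Lemma rational_combination_dense n (c : nat -> K) (e : R) : 0 < e ->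
  exists s, rnorm S (\sum_(i < n) c i *: x i - rational_combination s) < e.
Proof.
(* The length is fixed in the induction so that an appended pair becomes the coefficient of
   [x n]. *)
move=> e0; suff [s [_ se]] : exists s, size s = n /\
    rnorm S (\sum_(i < n) c i *: x i - rational_combination s) < e by exists s.
elim: n e e0 => [|n IH] e e0.
  by exists [::]; split=> //; rewrite /rational_combination !big_ord0 subrr rnorm0.
have [|s [sn se]] := IH (e / 2); first by rewrite divr_gt0.
have xn : 0 < 1 + rnorm S (x n) by rewrite ltr_pwDl ?rnorm_ge0.
have [|pq pqP] := @rational_scalar_dense (c n) (e / 2 / (1 + rnorm S (x n))).
  by rewrite !divr_gt0.
exists (rcons s pq); rewrite size_rcons sn; split=> //.
have -> : rational_combination (rcons s pq) =
    rational_combination s + rational_scalar pq *: x n.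
  rewrite /rational_combination size_rcons big_ord_recr/= nth_rcons ltnn eqxx sn.
  by congr (_ + _); apply: eq_bigr => i _; rewrite nth_rcons sn ltn_ord.
rewrite big_ord_recr/= opprD addrACA -scalerBl.
rewrite (le_lt_trans (rnormD _ _ _))// [ltRHS]splitr ltr_leD// rnormZ.
move: pqP; rewrite ltr_pdivlMr// => /ltW; apply: le_trans.
by rewrite ler_wpM2l ?rnorm_ge0// lerDr.
Qed.

Lemma norming_operator : exists T : {linear X -> linfty S},
  bounded_operators X (linfty S) T /\
  forall n (c : nat -> K), rnorm S (\sum_(i < n) c i *: x i) <=
    2 * rnorm S (T (\sum_(i < n) c i *: x i)).
Proof.
have [F FP] := choice (fun s => hahn_banach S (rational_combination s)).
(* Codes of no list fall back on the functional of the empty list, which obeys the same bound. *)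
pose h n := F (odflt [::] (unpickle n)).
have hle n y : rnorm S (h n y : K) <= 2 * rnorm S y by exact: (FP _).1.
have hP y : (fun n => h n y : K) \in bounded_seq S.
  by apply/asboolP; exists (2 * rnorm S y).
pose t y : linfty S := Linfty (hP y).
have tlin : linear t by move=> a y z; apply: linftyE => n; exact: linearP.
pose T := HB.pack_for {linear X -> linfty S} t
  (GRing.isLinear.Build _ _ _ _ t tlin).
exists T; split.
  (* The constant 4 works because 3 (2r)^2 <= (4r)^2. *)
  exists (of_real S 4) => y; rewrite -(of_rnorm S y) -rmorphM -rnorm_le.
  rewrite rnorm_linfty; apply: bnorm_le => [|k M].
    by rewrite mulr_ge0 ?rnorm_ge0.
  apply: (le_trans (@wsq_le_sqr _ _ S k M _ (2 * rnorm S y) _)) => [n _|].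
    exact: hle.
  nra.
move=> n c; set v := \sum_(i < n) c i *: x i.
have [->|v0] := eqVneq v 0; first by rewrite rnorm0 mulr_ge0 ?rnorm_ge0.
have rv : 0 < rnorm S v by rewrite lt_neqAle eq_sym rnorm_eq0 v0 rnorm_ge0.
(* With d = |v - w|, |v| <= d + |F s w| <= 3 d + |F s v|, so d < |v|/6 leaves |v|/2 <= |T v|. *)
have [|s sv] := @rational_combination_dense n c (rnorm S v / 6).
  by rewrite divr_gt0.
rewrite -/v in sv; set w := rational_combination s in sv.
have hs : h (pickle s) = F s by rewrite /h pickleK.
have Tv : rnorm S (F s v : K) <= rnorm S (T v).
  by rewrite rnorm_linfty -hs; exact: (rnorm_le_bnorm (T v)).
have [Fle Fw] := FP s.
have Fwv : rnorm S (F s w - F s v : K) <= 2 * rnorm S (v - w).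
  by rewrite (rnormB _ v) -raddfB Fle.
have := rnormD S (F s w - F s v : K) (F s v); rewrite subrK.
have := rnormD S (v - w) w; rewrite subrK.
move: Fw; rewrite -/w.
lra.
Qed.

End NormingOperator.

(** * Separation of the norming operator from all norm-attaining operators *)

Theorem proposition2p15 (K : numFieldType) (hK : real_or_complex K)
  (X : completeNormedModType K) :
  ~ finite_dimensional X ->
  norm_locally_finitely_many_coordinates X ->
  ~ Lindenstrauss_property_A X.
Proof.
move=> Xinf Xloc XA.
have [R [S]] := real_or_complex_coords hK.
have [x xind] := independent_sequence Xinf.
have [T [Tb Tnorm]] := norming_operator S x.
(* Any distance below 1/2 contradicts the lower bound of [T]; 1/4 will give |v| <= |v|/2 for a
   nonzero v. *)
have [|A AN TA] := XA (linfty S) T Tb (of_real S 4^-1).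
  by rewrite of_real_gt0.
have TAb : bounded_operators X (linfty S) (T \- A).
  have [[M TM] [N AN']] := (Tb, AN.1); exists (M + N) => y /=.
  by rewrite mulrDl (le_trans (ler_normB _ _))// lerD.
have [n [f fA]] := norm_attaining_kernel S (@linfty_strictly_convex _ _ S) Xloc AN.
have [c [j jn cj] fc] := common_kernel_combination x f.
set v := \sum_(i < _) _ in fc.
have v0 : 0 < rnorm S v.
  rewrite lt_neqAle eq_sym rnorm_eq0 rnorm_ge0 andbT; apply/eqP => v0.
  by rewrite (independent_sequence_eq0 xind v0 jn) eqxx in cj.
(* On [v] the operator [A] vanishes, so [T \- A] agrees with [T] there. *)
have := ler_opnorm S v TAb; rewrite /= (fA v fc) subr0.
have := Tnorm n.+1 c; rewrite -/v /= => vT.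
have : opnorm (T \- A) * `|v| <= of_real S (4^-1 * rnorm S v).
  by rewrite rmorphM of_rnorm ler_wpM2r// ltW.
move=> /[swap] /le_trans /[apply]; rewrite -rnorm_le.
lra.
Qed.
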